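(* Suppose $(S_t)$ is $l_0$-sub-gamma with variance process $(V_t)$ and scale parameter $c\in\mathbb R$. Then for any $x,m>0$ (with $x<1/(2|c|)$ if $c<0$), $$\mathbb P\left(\exists t\in\mathcal T:\frac{S_t}{V_t}\ge\mathfrak s_G(x)\left(1+\frac{m\sqrt{1+2cx}}{V_t}\right)\right)\le l_0\exp\{-m\psi_G^\star(x)\}\le l_0\exp\left\{-\frac{mx^2}{2(1+cx)}\right\}.$$ In the sub-Gaussian case (obtained at $c=0$), for any $x,m>0$, $$\mathbb P\left(\exists t\in\mathcal T:\frac{S_t}{V_t+m}\ge x\right)\le l_0\exp\{-2mx^2\}.$$
   Context: Time index: either $\mathcal T=\mathbb N=\{1,2,\dots\}$ or $\mathcal T=(0,\infty)$. Processes are adapted to a filtration $(\mathcal F_t)_{t\in\mathcal T\cup\{0\}}$ with $\mathcal F_0$ trivial; in continuous time the filtration is right-continuous and complete and $(S_t),(V_t)$ are càdlàg. Real-valued adapted $(S_t),(V_t)$ with $S_0=V_0=0$, $V_t\ge0$: $(S_t)$ is $l_0$-sub-gamma ($l_0\in[1,\infty)$) with scale $c\in\mathbb R$ and variance process $(V_t)$ if for each $\lambda\in[0,1/(c\vee0))$ (with $1/0=\infty$) there is a supermartingale $(L_t(\lambda))_{t\in\mathcal T\cup\{0\}}$ with $L_0(\lambda)\le l_0$ a.s. and $\exp\left\{\lambda S_t-\frac{\lambda^2}{2(1-c\lambda)}V_t\right\}\le L_t(\lambda)$ a.s. for all $t\in\mathcal T$. Sub-Gaussian is the case $c=0$. $\psi_G^\star(u)=\frac{u^2}{1+cu+\sqrt{1+2cu}}$,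 $\mathfrak s_G(u)=\frac u{1+\sqrt{1+2cu}}$. When $V_t=0$ the first event's inequality is read after multiplying through by $V_t$, i.e. as $S_t\ge\mathfrak s_G(x)(V_t+m\sqrt{1+2cx})$. *)

(* Defs.v *)
From HB Require Import structures.
From mathcomp Require Export all_boot all_order all_algebra.
From mathcomp Require Export all_classical all_reals all_analysis.

Set Implicit Arguments.
Unset Strict Implicit.
Unset Printing Implicit Defensive.

Import Order.TTheory GRing.Theory Num.Theory.
Import numFieldNormedType.Exports.

Local Open Scope classical_set_scope.
Local Open Scope ring_scope.

Variant time_kind := DiscreteTime | ContinuousTime.

(* Both time sets are realized as subsets of R, so that processes and
   filtrations are indexed by R; their values outside [times0] are irrelevant. *)
Definition times (R : realType) (k : time_kind) : set R :=
  match k with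
  | DiscreteTime => [set n.+1%:R | n in [set: nat]]
  | ContinuousTime => [set t | 0 < t]
  end.

Arguments times R k : clear implicits.

Definition times0 (R : realType) (k : time_kind) : set R :=
  [set 0] `|` times R k.

Arguments times0 R k : clear implicits.

Section processes.
Context {R : realType} {d : measure_display} {T : measurableType d}.
Variables (P : probability T R) (k : time_kind).
Implicit Types (F : R -> set_system T) (X : R -> T -> R).

Definition measurable_wrt (G : set_system T) (f : T -> R) : Prop :=
  preimage_set_system [set: T] f measurable `<=` G.

Record filtration F : Prop := {
  filtration_sigma : forall t, times0 R k t -> sigma_algebra [set: T] (F t);
  filtration_sub : forall t, times0 R k t -> F t `<=` measurable;
  filtration_mono : forall s t, times0 R k s -> times0 R k t -> s <= t ->
    F s `<=` F t }.

(* Triviality up to null sets, the only meaning compatible with F 0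
   containing all null sets. *)
Definition trivial_sigma (G : set_system T) : Prop :=
  forall A, G A -> P A = 0%E \/ P A = 1%E.

Definition filtration_right_continuous F : Prop :=
  forall t, times0 R k t ->
    F t = [set A | forall s, times0 R k s -> t < s -> F s A].

(* Since F 0 consists of measurable sets, this entails completeness of P. *)
Definition filtration_complete F : Prop :=
  forall A, P.-negligible A -> F 0 A.

Definition adapted F X : Prop :=
  forall t, times0 R k t -> measurable_wrt (F t) (X t).

Definition cadlag X : Prop :=
  forall w,
    (forall t, 0 <= t -> X s w @[s --> t^'+] --> X t w) /\
    (forall t, 0 < t -> cvg (X s w @[s --> t^'-])).

Record cond_exp (G : set_system T) (f g : T -> R) : Prop := {
  cond_exp_measurable : measurable_wrt G g;
  cond_exp_integrable : P.-integrable [set: T] (EFin \o g);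
  cond_exp_integral : forall A, G A ->
    (\int[P]_(w in A) (g w)%:E = \int[P]_(w in A) (f w)%:E)%E }.

Record supermartingale F X : Prop := {
  supermartingale_adapted : adapted F X;
  supermartingale_integrable : forall t, times0 R k t ->
    P.-integrable [set: T] (EFin \o X t);
  supermartingale_le : forall s t, times0 R k s -> times0 R k t -> s <= t ->
    exists2 g, cond_exp (F s) (X t) g & {ae P, forall w, g w <= X s w} }.

Record standing_assumptions F (S V : R -> T -> R) : Prop := {
  standing_filtration : filtration F;
  standing_trivial : trivial_sigma (F 0);
  standing_continuous : k = ContinuousTime ->
    [/\ filtration_right_continuous F, filtration_complete F,
        cadlag S & cadlag V] }.

(* The inverse is that of \bar R, for which 0^-1 = +oo. *)
Definition sub_gamma F (l0 c : R) (S V : R -> T -> R) : Prop :=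
  [/\ adapted F S /\ adapted F V,
      forall w, S 0 w = 0 /\ V 0 w = 0,
      forall t w, times R k t -> 0 <= V t w &
      forall lambda, 0 <= lambda -> (lambda%:E < ((Num.max c 0)%:E)^-1)%E ->
      exists L : R -> T -> R,
        [/\ supermartingale F L,
            {ae P, forall w, L 0 w <= l0} &
            forall t, times R k t ->
              {ae P, forall w,
                 expR (lambda * S t w
                       - lambda ^+ 2 / (2 * (1 - c * lambda)) * V t w)
                 <= L t w}]].

Definition sub_gaussian F (l0 : R) (S V : R -> T -> R) : Prop :=
  sub_gamma F l0 0 S V.

End processes.

Definition psiG_star (R : realType) (c u : R) : R :=
  u ^+ 2 / (1 + c * u + Num.sqrt (1 + 2 * c * u)).

Definition sG (R : realType) (c u : R) : R :=
  u / (1 + Num.sqrt (1 + 2 * c * u)).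

(* s / v >= sG(x) (1 + m sqrt(1 + 2cx) / v), multiplied through by v if v = 0. *)
Definition crosses (R : realType) (c x m s v : R) : Prop :=
  if v == 0 then s >= sG c x * (v + m * Num.sqrt (1 + 2 * c * x))
  else s / v >= sG c x * (1 + m * Num.sqrt (1 + 2 * c * x) / v).

(* Main.v *)
(* With [a = sqrt (1 + 2 c x)] and [lambda = 2 x / (a (1 + a))], the line that
   [S] has to cross against [V] is a level line of the exponent:
   [S >= sG x (V + m a)] is equivalent to
   [lambda S - lambda^2 / (2 (1 - c lambda)) V >= m psiG_star x].
   On such an event the dominating supermartingale reaches [exp (m psiG_star x)],
   and the maximal inequality bounds its probability.  As the supermartingale
   need not have regular paths, the maximal inequality is applied along a
   countable set of times, which suffices because [S] and [V] are
   right-continuous, at the price of an arbitrarily small loss in the level.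

   In continuous time, the measurability of the event needs an argument: a
   right-continuous process may attain a level at irrational times only.  Among
   the measurable random times in [0, N] before which the level is not attained,
   choose one of maximal expectation.  Wherever the level is not attained at that
   time, a later such time could be built from the rational times, so almost
   surely it is the hitting time or N; completeness of the filtration does the
   rest. *)
Require Import Defs.
From mathcomp Require Import all_boot all_order all_algebra.
From mathcomp Require Import all_classical all_reals all_analysis.
From mathcomp Require Import measurable_realfun.
From mathcomp Require Import ring lra.
Set Implicit Arguments.
Unset Strict Implicit.
Unset Printing Implicit Defensive.

Import Order.TTheory GRing.Theory Num.Theory.
Import numFieldNormedType.Exports.
Local Open Scope classical_set_scope.
Local Open Scope ring_scope.

(** * Ville's maximal inequality along countably many times *)

Lemma ae_integrable_le d (T : measurableType d) (R : realType)
    (mu : measure T R) (A : set T) (f g : T -> \bar R) :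
  measurable A -> mu.-integrable A f -> mu.-integrable A g ->
  {ae mu, forall w, f w <= g w}%E ->
  (\int[mu]_(w in A) f w <= \int[mu]_(w in A) g w)%E.
Proof.
move=> mA fi gi [N [mN N0 fgN]].
rewrite (negligible_integral mN mA fi N0) (negligible_integral mN mA gi N0).
have mD : measurable (A `\` N) by exact: measurableD.
have sD : A `\` N `<=` A by apply: subDsetl.
apply: le_integral => //; [exact: integrableS fi|exact: integrableS gi|].
move=> w; rewrite inE => -[_ Nw]; apply: contrapT => fgw.
by apply: Nw; apply: fgN.
Qed.

Lemma sigma_algebra_setI (T : Type) (G : set_system T) :
  sigma_algebra [set: T] G -> setI_closed G.
Proof. by case/(sigma_algebraP (fun X _ => @subsetT _ X)). Qed.

Section ville.
Context {R : realType} {d : measure_display} {T : measurableType d}.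
Variables (P : probability T R) (k : time_kind) (F : R -> set_system T).
Hypothesis hF : filtration k F.
Implicit Types (L : R -> T -> R) (A : set T) (a : R).

Lemma supermartingale_integral_le L s t A :
  supermartingale P k F L -> times0 R k s -> times0 R k t -> s <= t ->
  F s A ->
  (\int[P]_(w in A) (L t w)%:E <= \int[P]_(w in A) (L s w)%:E)%E.
Proof.
move=> hL hs ht st FA.
have mA : measurable A by exact: filtration_sub hF _ hs _ FA.
have [g [_ gi gE] gL] := supermartingale_le hL hs ht st.
rewrite -(gE _ FA); apply: ae_integrable_le => //.
- exact: integrableS gi.
- by apply: integrableS (supermartingale_integrable hL hs).
Qed.

Lemma adapted_ge L t a : adapted k F L -> times0 R k t ->
  F t [set w | a <= L t w].
Proof.
move=> hL ht; apply: (hL t ht); exists `[a, +oo[%classic => //.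
by rewrite setTI; apply/seteqP; split=> w /=; rewrite in_itv /= andbT.
Qed.

Lemma measurable_has_ge L (s : seq R) a : adapted k F L ->
  (forall t, t \in s -> times0 R k t) ->
  measurable [set w | has (fun t => a <= L t w) s].
Proof.
move=> hL; elim: s => [|t s IH] hs.
  by rewrite [X in measurable X](_ : _ = set0) //; apply/seteqP; split.
have -> : [set w | has (fun t => a <= L t w) (t :: s)] =
    [set w | a <= L t w] `|` [set w | has (fun t => a <= L t w) s].
  by apply/seteqP; split=> w /= /orP.
have ht : times0 R k t by apply: hs; rewrite mem_head.
apply: measurableU.
  by apply: (filtration_sub hF ht); exact: adapted_ge.
by apply: IH => u us; apply: hs; rewrite in_cons us orbT.
Qed.

(** [A] splits at the level [a]: where [L t] has reached it, the integral is at least [a] times the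
    probability; the remaining part is again in [F t], so it can serve as the starting event for the
    next time. *)
Lemma ville_step L t a A : supermartingale P k F L -> times0 R k t -> F t A ->
  (a%:E * P (A `&` [set w | (a <= L t w)%R])
     + \int[P]_(w in A `&` [set w | (L t w < a)%R]) (L t w)%:E
   <= \int[P]_(w in A) (L t w)%:E)%E /\ F t (A `&` [set w | L t w < a]).
Proof.
move=> hL ht FA.
pose B := [set w | a <= L t w].
have -> : [set w | L t w < a] = ~` B.
  by apply/seteqP; split=> w /=; rewrite ltNge => /negP.
have Fsigma := filtration_sigma hF ht.
have FB : F t B by apply: adapted_ge (supermartingale_adapted hL) ht.
have FC : F t (~` B) by case: Fsigma => _ + _; rewrite -setTD; apply.
have FAB : F t (A `&` B) by exact: sigma_algebra_setI.
have FAC : F t (A `&` ~` B) by exact: sigma_algebra_setI.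
split=> //.
have mF := filtration_sub hF ht.
have Lti := supermartingale_integrable hL ht.
have intA : (\int[P]_(w in A) (L t w)%:E = \int[P]_(w in A `&` B) (L t w)%:E
   + \int[P]_(w in A `&` ~` B) (L t w)%:E)%E.
  rewrite -integral_setU; [|exact: mF|exact: mF| |].
  - by rewrite -setIUr setUv setIT.
  - by apply: measurable_funTS; exact: measurable_int Lti.
  - by apply/disj_setPS => w /= [[_ h] [_]].
rewrite intA leeD2r // -integral_cst; last exact: mF.
apply: le_integral; first exact: mF.
- by apply: finite_measure_integrable_cst; exact: mF.
- by apply: integrableS Lti => //; exact: mF.
- by move=> w; rewrite inE => -[_ /= Bw]; rewrite lee_fin.
Qed.

Lemma ville_path L (t : R) (s : seq R) a A : supermartingale P k F L -> 0 < a ->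
  path <=%R t s ->
  (forall u, u \in t :: s -> times0 R k u /\ {ae P, forall w, 0 <= L u w}) ->
  F t A ->
  (a%:E * P (A `&` [set w | has (fun u => (a <= L u w)%R) (t :: s)])
   <= \int[P]_(w in A) (L t w)%:E)%E.
Proof.
move=> hL a0; elim: s t A => [|u s IH] t A pth hs FA.
all: have [ht Lt0] := hs t (mem_head _ _).
all: have [step FAC] := ville_step a hL ht FA.
all: apply: le_trans step.
  rewrite [X in A `&` X](_ : _ = [set w | a <= L t w]); last first.
    by apply/seteqP; split=> w /=; rewrite orbF.
  rewrite -[leLHS]adde0 leeD2l //.
  have mAC := filtration_sub hF ht FAC.
  rewrite -(integral0 P (A `&` [set w | L t w < a])).
  apply: ae_integrable_le => //; first exact: integrable0.
  by apply: integrableS (supermartingale_integrable hL ht).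
move: pth => /= /andP[tu pth].
have hs' v : v \in u :: s -> times0 R k v /\ {ae P, forall w, 0 <= L v w}.
  by move=> vs; apply: hs; rewrite in_cons vs orbT.
have [hu _] := hs' u (mem_head _ _).
have FAC' := filtration_mono hF ht hu tu FAC.
have mH (r : seq R) : (forall v, v \in r -> times0 R k v) ->
    measurable [set w | has (fun v => a <= L v w) r].
  exact: measurable_has_ge (supermartingale_adapted hL).
have mHu := mH (u :: s) (fun v vs => (hs' v vs).1).
have mB : measurable [set w | a <= L t w].
  by apply: (filtration_sub hF ht); apply: adapted_ge (supermartingale_adapted hL) ht.
have mA := filtration_sub hF ht FA.
have mAC := filtration_sub hF ht FAC.
(* The level is reached at [t], or at a later time from below it at [t]. The second event is bounded
   by the integral of [L u], which the supermartingale property brings back to time [t]. *)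
apply: (@le_trans _ _ (a%:E * P (A `&` [set w | (a <= L t w)%R]) +
   a%:E * P (A `&` [set w | (L t w < a)%R] `&`
             [set w | has (fun v => (a <= L v w)%R) (u :: s)]))%E).
  rewrite -ge0_muleDr // lee_pmul2l ?lte_fin //.
  apply: le_trans (measureU2 _ _ _); [|exact: measurableI|exact: measurableI].
  apply: le_measure.
  - rewrite inE; apply: measurableI => //.
    by apply: (mH [:: t, u & s]) => v vs; exact: (hs v vs).1.
  - by rewrite inE; apply: measurableU; exact: measurableI.
  - move=> w /= [Aw] /orP[h|h]; first by left.
    by case: (leP a (L t w)) => h'; [left|right].
rewrite leeD2l //; apply: le_trans (IH _ _ pth hs' FAC') _.
exact: supermartingale_integral_le.
Qed.

(** The finite unions [B n] increase to the event, so a bound uniform in [n] passes to the limit. *)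
Lemma ville_countable L (u : nat -> R) a l0 :
  supermartingale P k F L -> 0 < a -> 0 <= l0 ->
  {ae P, forall w, L 0 w <= l0} ->
  (forall n, times R k (u n) /\ {ae P, forall w, 0 <= L (u n) w}) ->
  (P [set w | exists n, (a <= L (u n) w)%R] <= (l0 / a)%:E)%E.
Proof.
move=> hL a0 l00 L0 hu.
have h0 : times0 R k 0 by left.
have times_ge0 v : times R k v -> 0 <= v.
  by case: (k) => /=; [case=> n _ <-|exact: ltW].
pose B n := [set w | has (fun v => a <= L v w) [seq u i | i <- iota 0 n]].
have hs n v : v \in [seq u i | i <- iota 0 n] ->
    times R k v /\ {ae P, forall w, 0 <= L v w}.
  by case/mapP => i _ ->.
have -> : [set w | exists n, a <= L (u n) w] = \bigcup_n B n.
  apply/seteqP; split=> w /=.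
    case=> n h; exists n.+1 => //; apply/hasP.
    exists (u n); last exact: h.
    by apply: map_f; rewrite mem_iota add0n leqnn.
  by case=> n _ /hasP[v /mapP[i _ ->]] h; exists i.
have mB n : measurable (B n).
  by apply: measurable_has_ge (supermartingale_adapted hL) _ => v /hs[]; right.
have Bmono : {homo B : n m / (n <= m)%N >-> (n <= m)%O}.
  move=> n m nm; apply/subsetPset => w /hasP[v /mapP[i]].
  rewrite mem_iota => /andP[_ ni] -> h; apply/hasP; exists (u i) => //.
  by apply: map_f; rewrite mem_iota /=; exact: leq_trans nm.
have PB n : (P (B n) <= (l0 / a)%:E)%E.
  (* [u] need not be monotone; the event ignores the order of the times, so they may be sorted. *)
  have BS : B n = [set w | has (fun v => a <= L v w)
                    (sort <=%R [seq u i | i <- iota 0 n])].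
    by apply/seteqP; split=> w; rewrite /B /= (eq_has_r (mem_sort _ _)).
  have FT v : times0 R k v -> F v [set: T].
    by move=> /(filtration_sigma hF)[? + _]; rewrite -{2}(setD0 [set: T]); apply.
  have intL v : times R k v -> (\int[P]_w (L v w)%:E <= l0%:E)%E.
    move=> hv; have hv0 : times0 R k v by right.
    apply: (@le_trans _ _ (\int[P]_w (L 0 w)%:E)%E).
      by apply: supermartingale_integral_le => //; [exact: times_ge0|exact: FT].
    rewrite -[leRHS]mule1 -(probability_setT P) -integral_cst //.
    apply: ae_integrable_le => //; first exact: supermartingale_integrable hL _ h0.
    exact: finite_measure_integrable_cst.
  have hS v : v \in sort <=%R [seq u i | i <- iota 0 n] ->
      times R k v /\ {ae P, forall w, 0 <= L v w}.
    by rewrite mem_sort; exact: hs.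
  have := sort_sorted (@le_total _ R) [seq u i | i <- iota 0 n].
  rewrite BS EFinM lee_pdivlMr // muleC.
  case: (sort _ _) hS => [|v s] hS pth.
    by rewrite [X in P X](_ : _ = set0) ?measure0 ?mule0 ?lee_fin//; apply/seteqP; split.
  have hv := (hS v (mem_head _ _)).1.
  apply: le_trans (intL v hv); rewrite -[X in P X]setTI.
  apply: ville_path => //; last by apply: FT; right.
  by move=> x /hS[]; split=> //; right.
have cvgB := nondecreasing_cvg_mu (mu := P) mB (bigcup_measurable (fun n _ => mB n)) Bmono.
rewrite -(cvg_lim _ cvgB) //; apply: lime_le.
  by apply/cvg_ex; eexists; exact: cvgB.
by apply: nearW => n; exact: PB.
Qed.

End ville.

(** * Countable infima and suprema, and dense sequences of times *)

Lemma measurable_fun_inf_range d (T : measurableType d) (R : realType)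
    (h : nat -> T -> R) : (forall w, has_lbound (range (h ^~ w))) ->
  (forall n, measurable_fun [set: T] (h n)) ->
  measurable_fun [set: T] (fun w => inf (range (h ^~ w))).
Proof.
move=> lbh mh; have := measurable_fun_infs 0 (fun w _ => lbh w) mh.
rewrite /infs /sdrop/=; congr measurable_fun.
by apply/funext => w; congr inf; apply/seteqP; split=> x [i _ <-]; exists i.
Qed.

Lemma measurable_fun_sup_range d (T : measurableType d) (R : realType)
    (h : nat -> T -> R) : (forall w, has_ubound (range (h ^~ w))) ->
  (forall n, measurable_fun [set: T] (h n)) ->
  measurable_fun [set: T] (fun w => sup (range (h ^~ w))).
Proof.
move=> ubh mh; have := measurable_fun_sups 0 (fun w _ => ubh w) mh.
rewrite /sups /sdrop/=; congr measurable_fun.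
by apply/funext => w; congr sup; apply/seteqP; split=> x [i _ <-]; exists i.
Qed.

Lemma pos_dense_seq (R : realType) : exists u : nat -> R,
  (forall n, 0 < u n) /\ (forall x y, 0 <= x -> x < y -> exists n, x < u n < y).
Proof.
(* The positive rationals; codes of anything else are sent to 1, which keeps every term positive. *)
pose u n : R := if (unpickle n : option rat) is Some q then
  (if 0 < q then ratr q else 1) else 1.
exists u; split=> [n|x y x0 xy].
  rewrite /u; case: (unpickle n) => [q|//].
  by case: ifPn => // q0; rewrite ltr0q.
have [q] := rat_in_itvoo xy; rewrite in_itv /= => /andP[xq qy].
exists (pickle q); rewrite /u pickleK.
by have := le_lt_trans x0 xq; rewrite ltr0q => ->; rewrite xq.
Qed.

(** A strict inequality persists on an interval to the right of [t], and this interval contains a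
    term of [u]. A non-strict one need not persist, whence the loss [e] in the levels below. *)
Lemma right_continuous_dense (R : realType) (u : nat -> R) (f : R -> R)
    (t t' K : R) :
  (forall x y, 0 <= x -> x < y -> exists n, x < u n < y) ->
  0 <= t -> t < t' -> f s @[s --> t^'+] --> f t -> K < f t ->
  exists n, t < u n < t' /\ K < f (u n).
Proof.
move=> u_dense t0 tt' rcf Kt.
have [e /= e0 He] := cvgr_gt _ rcf _ Kt.
have tm : t < Num.min t' (t + e) by rewrite lt_min tt' ltrDl.
have [n /andP[tn]] := u_dense _ _ t0 tm.
rewrite lt_min => /andP[nt' nte]; exists n; split; first by rewrite tn.
by apply: He => //=; rewrite ltr_distlC (lt_trans _ tn) ?nte// gtrBl.
Qed.

(** * Measurability of the hitting event on a bounded interval *)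

Section hitting.
Context {R : realType} {d : measure_display} {T : measurableType d}.
Variables (P : probability T R) (X : R -> T -> R) (b N : R).
Hypothesis N0 : 0 <= N.
Hypothesis mX : forall t : R, 0 <= t -> measurable_fun [set: T] (X t).
Hypothesis rcX : forall (w : T) (t : R), 0 <= t -> X s w @[s --> t^'+] --> X t w.
Variable u : nat -> R.
Hypothesis u0 : forall n, 0 < u n.
Hypothesis u_dense : forall x y : R, 0 <= x -> x < y -> exists n, x < u n < y.
Implicit Types (tau : T -> R) (w : T) (t e : R).

(** The level may be attained at [tau w] itself, so the hitting time is not excluded. Measurability
    is with respect to the whole sigma-algebra: these are random times, not stopping times. *)
Definition before_hitting tau := [/\ measurable_fun [set: T] tau,
  forall w, 0 <= tau w <= N & forall w t, 0 <= t -> t < tau w -> X t w < b].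

(* [N] stands for: no visit above [b - e] after [tau] is seen at time [u n]. *)
Let candidate tau e n w :=
  if [&& tau w < u n, u n <= N & b - e < X (u n) w] then u n else N.

Definition next_time tau e w := inf (range (candidate tau e ^~ w)).

Lemma candidate_ge tau e n w : 0 <= tau w <= N -> tau w <= candidate tau e n w.
Proof. by move=> /andP[_ tN]; rewrite /candidate; case: ifP => // /and3P[/ltW]. Qed.

Lemma candidate_lb tau e w : 0 <= tau w <= N ->
  has_lbound (range (candidate tau e ^~ w)).
Proof. by move=> tN; exists (tau w) => _ [n _ <-]; exact: candidate_ge. Qed.

Lemma next_time_ge tau e w : 0 <= tau w <= N -> tau w <= next_time tau e w.
Proof.
move=> tN; apply: lb_le_inf; first by exists (candidate tau e 0 w), 0.
by move=> _ [n _ <-]; exact: candidate_ge.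
Qed.

Lemma next_time_le tau e n w : 0 <= tau w <= N ->
  next_time tau e w <= candidate tau e n w.
Proof. by move=> tN; apply: ge_inf; [exact: candidate_lb|exists n]. Qed.

Lemma next_time_leN tau e w : 0 <= tau w <= N -> next_time tau e w <= N.
Proof.
move=> tN; apply: le_trans (next_time_le e 0 tN) _; rewrite /candidate.
by case: ifP => // /and3P[].
Qed.

(** A visit to [b] at a time [t] in between would, by right-continuity, make some [u n] strictly
    between [t] and [next_time] a candidate, contradicting the infimum. *)
Lemma before_hitting_next tau e : 0 < e -> before_hitting tau ->
  before_hitting (next_time tau e).
Proof.
move=> e0 [mtau tauN tauX]; split.
- apply: measurable_fun_inf_range => [w|n]; first exact: candidate_lb.
  apply: measurable_fun_ifT => //; apply: measurable_and.
    exact: measurable_fun_ltr.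
  apply: measurable_and; first exact: measurable_cst.
  by apply: measurable_fun_ltr => //; apply: mX; exact: ltW.
- move=> w; rewrite next_time_leN// andbT.
  by apply: le_trans (next_time_ge _ _) => //; case/andP: (tauN w).
- move=> w t t0 tn; case: (ltP t (tau w)) => [|taut]; first exact: tauX.
  rewrite ltNge; apply/negP => bX.
  have bX' : b - e < X t w by apply: lt_le_trans bX; rewrite gtrBl.
  have [n [/andP[tun unn] Xun]] := right_continuous_dense u_dense t0 tn (rcX t0) bX'.
  have := next_time_le e n (tauN w).
  rewrite /candidate (le_lt_trans taut tun) Xun.
  rewrite (ltW (lt_le_trans unn (next_time_leN e (tauN w)))) /=.
  by rewrite leNgt unn.
Qed.

(** If [X] is below [b] at [tau], it is below some [b - 1/(n+1)] there and, by right-continuity, on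
    an interval after it. No candidate falls in that interval, so the infimum moves strictly to the
    right. *)
Lemma next_time_gt tau w : 0 <= tau w <= N -> tau w < N -> X (tau w) w < b ->
  exists n, tau w < next_time tau n.+1%:R^-1 w.
Proof.
move=> tauN tN Xb.
have [n] : exists n, X (tau w) w < b - n.+1%:R^-1.
  have bX : 0 < b - X (tau w) w by rewrite subr_gt0.
  have [n _ /(_ n (leqnn n))] := near_infty_natSinv_lt (PosNum bX).
  by move=> h; exists n; rewrite ltrBrDr -ltrBrDl; exact: h.
move=> Xn; exists n.
have t0 : 0 <= tau w by case/andP: tauN.
have [e /= e0 He] := cvgr_lt _ (rcX (w := w) t0) _ Xn.
apply: (@lt_le_trans _ _ (Num.min N (tau w + e))).
  by rewrite lt_min tN ltrDl.
apply: lb_le_inf; first by exists (candidate tau n.+1%:R^-1 0 w), 0.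
move=> _ [i _ <-]; rewrite /candidate; case: ifP; last by rewrite ge_min lexx.
move=> /and3P[taui iN Xi]; rewrite ge_min; apply/orP; right.
rewrite leNgt; apply/negP => ie.
have := He (u i); rewrite /= ltr_distlC ie (lt_trans _ taui) ?gtrBl//.
by move=> /(_ isT taui); rewrite ltNge (ltW Xi).
Qed.

Lemma before_hitting_sup (tau : nat -> T -> R) :
  (forall n, before_hitting (tau n)) ->
  before_hitting (fun w => sup (range (tau ^~ w))) /\
  (forall n w, tau n w <= sup (range (tau ^~ w))).
Proof.
move=> htau.
have ub w : has_ubound (range (tau ^~ w)).
  by exists N => _ [n _ <-]; have [_ /(_ w)/andP[]] := htau n.
have le_sup n w : tau n w <= sup (range (tau ^~ w)).
  by apply: ub_le_sup => //; exists n.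
have ne w : range (tau ^~ w) !=set0 by exists (tau 0 w), 0.
split=> //; split.
- by apply: measurable_fun_sup_range => // n; have [] := htau n.
- move=> w; apply/andP; split.
    by apply: le_trans (le_sup 0 w); have [_ /(_ w)/andP[]] := htau 0.
  by apply: ge_sup => // _ [n _ <-]; have [_ /(_ w)/andP[]] := htau n.
- move=> w t t0 /(sup_gt (ne w))[_ [n _ <-]].
  by have [_ _] := htau n; exact.
Qed.

(** The pointwise supremum of a sequence whose expectations approach the supremum [M] has
    expectation at least [M]. A later [sigma] has expectation at most [M], so the nonnegative
    difference integrates to 0. *)
Lemma before_hitting_maximal : exists2 tau, before_hitting tau &
  forall sigma, before_hitting sigma -> (forall w, tau w <= sigma w) ->
  P.-negligible [set w | tau w < sigma w].
Proof.
pose I tau := (\int[P]_w (tau w)%:E)%E.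
pose M := ereal_sup (I @` before_hitting).
have bh0 : before_hitting (cst 0).
  by split=> // [w|w t t0]; rewrite /= ?lexx// ltNge t0.
have intI tau : before_hitting tau -> P.-integrable [set: T] (EFin \o tau).
  move=> [mtau tauN _].
  apply: (le_integrable measurableT _ _ (finite_measure_integrable_cst P N measurableT)).
    exact/measurable_EFinP.
  by move=> w _; have /andP[? ?] := tauN w; rewrite /= lee_fin !ger0_norm.
have I_le tau : before_hitting tau -> (I tau <= N%:E)%E.
  move=> h; rewrite -[leRHS]mule1 -(probability_setT P) -integral_cst //.
  apply: le_integral => //; first exact: intI.
    exact: finite_measure_integrable_cst.
  by move=> w _; rewrite lee_fin; have [_ /(_ w)/andP[]] := h.
have Mfin : M \is a fin_num.
  rewrite fin_numE -ltNye -ltey; apply/andP; split.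
    apply: (@lt_le_trans _ _ (I (cst 0))); first by rewrite /I integral0.
    by apply: ereal_sup_ubound; exists (cst 0).
  apply: (@le_lt_trans _ _ N%:E); last by rewrite ltry.
  by apply: ge_ereal_sup => _ [tau h <-]; exact: I_le.
have ex n : exists tau, before_hitting tau /\ (M - n.+1%:R^-1%:E < I tau)%E.
  have n0 : 0 < n.+1%:R^-1 :> R by rewrite invr_gt0.
  have [_ [tau h <-]] := ub_ereal_sup_adherent n0 Mfin.
  by exists tau.
have [tau_ htau] := choice ex.
have [hsup le_sup] := before_hitting_sup (fun n => (htau n).1).
pose tau w := sup (range (tau_ ^~ w)).
have MI : (M <= I tau)%E.
  apply/lee_addgt0Pr => e e0.
  have [n _ /(_ n (leqnn n)) /= ne] := near_infty_natSinv_lt (PosNum e0).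
  have [hn In] := htau n.
  rewrite -leeBlDr //; apply: (@le_trans _ _ (I (tau_ n))); last first.
    apply: le_integral => //; [exact: intI|exact: intI|].
    by move=> w _; rewrite lee_fin; exact: le_sup.
  apply: le_trans (ltW In); rewrite leeB// lee_fin; exact: ltW.
exists tau => // sigma hs ts.
have Is : (I sigma <= M)%E by apply: ereal_sup_ubound; exists sigma.
have [[msigma _ _] [mtau _ _]] := (hs, hsup).
have int0 : (\int[P]_w `|(sigma w - tau w)%:E| = 0)%E.
  under eq_integral do rewrite abse_EFin ger0_norm ?subr_ge0// EFinB.
  apply/eqP; rewrite eq_le; apply/andP; split; last first.
    by apply: integral_ge0 => w _; rewrite -EFinB lee_fin subr_ge0.
  rewrite integralB_EFin //; [|exact: intI|exact: intI].
  by rewrite sube_le0; exact: le_trans MI.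
have mst : measurable_fun [set: T] (EFin \o (fun w => sigma w - tau w)).
  by apply/measurable_EFinP; exact: measurable_funB.
have := (ae_eq_integral_abs P measurableT mst).1 int0.
apply: negligibleS => w /= lt_ts /(_ Logic.I) [] /eqP.
by rewrite subr_eq0 gt_eqF.
Qed.

Lemma measurable_hitting : (forall A, P.-negligible A -> measurable A) ->
  measurable [set w | exists2 t, 0 <= t <= N & b <= X t w].
Proof.
move=> complete; have [tau htau max] := before_hitting_maximal.
have [mtau tauN tauX] := htau.
pose Z := \bigcup_n [set w | tau w < next_time tau n.+1%:R^-1 w].
have Z0 : P.-negligible Z.
  apply: negligible_bigcup => n; apply: max.
    by apply: before_hitting_next => //; rewrite invr_gt0.
  by move=> w; exact: next_time_ge.
set E := [set w | _].
(* Outside [Z], stopping before [N] means that the level is attained there, and stopping at [N]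
   leaves only the value at [N] to check. So [E] and [G] agree outside [Z]. *)
pose G := [set w | tau w < N] `|` [set w | b <= X N w].
have mG : measurable G.
  apply: measurableU; rewrite -[X in measurable X]setTI.
    by apply: (measurable_fun_ltr mtau (@measurable_cst _ _ _ _ _ N) measurableT (Y := [set true])).
  by apply: measurable_fun_le => //; exact: mX.
have mZ : measurable Z by exact: complete.
have mEZ : measurable (E `&` Z) by apply: complete; apply: negligibleS Z0.
suff -> : E = (G `\` Z) `|` (E `&` Z) by apply: measurableU => //; exact: measurableD.
have stop w : ~ Z w -> tau w < N -> b <= X (tau w) w.
  move=> Zw tN; rewrite leNgt; apply/negP => /(next_time_gt (tauN w) tN)[n tn].
  by apply: Zw; exists n.
apply/seteqP; split=> [w [t /andP[t0 tN] bX]|w [[Gw Zw]|[]//]].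
  have [Zw|Zw] := pselect (Z w); [by right; split=> //; exists t; rewrite ?t0|left; split=> //].
  have taut : tau w <= t.
    by rewrite leNgt; apply/negP => /(tauX _ _ t0); rewrite ltNge bX.
  have [tauN'|] := ltP (tau w) N; first by left.
  move=> /le_trans /(_ taut) Nt; right => /=.
  by have <- : t = N by apply/eqP; rewrite eq_le tN.
case: Gw => /= [tN|bX]; last by exists N; rewrite ?N0 ?lexx.
by exists (tau w) => //; exact: stop.
Qed.

End hitting.

(** * Probability that [S] crosses a line in [V] *)

Lemma adapted_measurable_fun (R : realType) (d : measure_display)
    (T : measurableType d) k (F : R -> set_system T)
    (X : R -> T -> R) t :
  filtration k F -> adapted k F X -> times0 R k t ->
  measurable_fun [set: T] (X t).
Proof.
move=> hF hX ht _ Y mY.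
by apply: (filtration_sub hF ht); apply: (hX t ht); exists Y.
Qed.

(** Treats both time sets at once: in discrete time [u] lists all times and [f] may be arbitrary, in
    continuous time density and right-continuity are combined. *)
Lemma times_dense_seq (R : realType) (k : time_kind) : exists u : nat -> R,
  (forall n, times R k (u n)) /\
  forall f : R -> R,
    (k = ContinuousTime -> forall t, 0 <= t -> f s @[s --> t^'+] --> f t) ->
    forall t K, times R k t -> K < f t -> exists n, K < f (u n).
Proof.
case: k => /=.
  exists (fun n => n.+1%:R); split=> [n|f _ _ K [n _ <-] Kn]; last by exists n.
  by exists n.
have [u [u0 u_dense]] := pos_dense_seq R; exists u; split=> // f rcf t K t0 Kt.
have tt1 : t < t + 1 by rewrite ltrDl.
have [n [_ Kn]] :=
  right_continuous_dense u_dense (ltW t0) tt1 (rcf erefl t (ltW t0)) Kt.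
by exists n.
Qed.

Section line_crossing.
Context {R : realType} {d : measure_display} {T : measurableType d}.
Variables (P : probability T R) (k : time_kind) (F : R -> set_system T).
Variables (S V : R -> T -> R) (l0 c : R).
Hypothesis hFSV : standing_assumptions P k F S V.
Hypothesis l0_ge1 : 1 <= l0.
Hypothesis hSV : sub_gamma P k F l0 c S V.
Variables (lambda beta b : R).
Hypothesis lambda_ge0 : 0 <= lambda.
Hypothesis lambda_lt : (lambda%:E < ((Num.max c 0)%:E)^-1)%E.
Hypothesis lambda_beta : lambda * beta = lambda ^+ 2 / (2 * (1 - c * lambda)).
Hypothesis b_gt0 : 0 < b.

(** Subtracting the slope turns the line into a constant level; by [lambda_beta], [lambda * X] is
    the sub-gamma exponent. *)
Let X t w := S t w - beta * V t w.
Let E := [set w | exists2 t, times R k t & b <= X t w].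

Let X_measurable t : times0 R k t -> measurable_fun [set: T] (X t).
Proof.
move=> ht; have hF := standing_filtration hFSV.
have [[aS aV] _ _ _] := hSV.
apply: measurable_funB; first exact: adapted_measurable_fun hF aS ht.
by apply: measurable_funM => //; exact: adapted_measurable_fun hF aV ht.
Qed.

Let X_right_continuous : k = ContinuousTime ->
  forall w t, 0 <= t -> X s w @[s --> t^'+] --> X t w.
Proof.
move=> hk w t t0; have [_ _ hS hV] := standing_continuous hFSV hk.
apply: cvgB; first exact: (hS w).1.
by apply: cvgM; [exact: cvg_cst|exact: (hV w).1].
Qed.

Lemma measurable_line_crossing : measurable E.
Proof.
(* The hitting events on [[0, n]] include time 0, which [times] does not; as [X 0 = 0 < b], nothing
   is added. *)
have X0 w : X 0 w = 0.
  by have [_ /(_ w)[S0 V0] _ _] := hSV; rewrite /X S0 V0 mulr0 subr0.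
rewrite /E; case hk : k.
  rewrite [X in measurable X](_ : _ = \bigcup_n [set w | b <= X n.+1%:R w]).
    apply: bigcup_measurable => n _; rewrite -[X in measurable X]setTI.
    apply: measurable_fun_le => //; apply: X_measurable; right; rewrite hk.
    by exists n.
  by apply/seteqP; split=> w [t]; [case=> n _ <- h; exists n|
    move=> _ h; exists t.+1%:R => //; exists t].
have [_ complete _ _] := standing_continuous hFSV hk.
have zero_time : times0 R k 0 by left.
(* Negligible sets belong to [F 0] by completeness, hence are measurable. *)
have mF := filtration_sub (standing_filtration hFSV) zero_time.
have [u [u0 u_dense]] := pos_dense_seq R.
rewrite [X in measurable X](_ : _ =
  \bigcup_n [set w | exists2 t, 0 <= t <= n%:R & b <= X t w]).
  apply: bigcup_measurable => n _.
  apply: (measurable_hitting (P := P)) u0 u_dense _ => //.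
  - move=> t t0; apply: X_measurable; rewrite hk /times0 /=.
    by have [->|tn0] := eqVneq t 0; [left|right; rewrite lt_neqAle eq_sym tn0].
  - by move=> w t; exact: X_right_continuous.
  - by move=> A /complete /mF.
apply/seteqP; split=> w.
  move=> [t /= t0 bX]; exists (Num.truncn t).+1 => //; exists t => //.
  by rewrite (ltW t0) ltW // truncnS_gt.
move=> [n _ [t /andP[t0 _] bX]]; exists t => //=; rewrite lt_neqAle t0 andbT.
by apply/negP => /eqP t0'; move: bX; rewrite -t0' X0 leNgt b_gt0.
Qed.

(** A crossing of [b] by [X] forces [X > b - e] at some [u n]. Domination by [L] fails on a null set
    for each time, and only the countable union of these sets over the times [u n] has to be
    discarded. *)
Let relaxed_line_crossing e : 0 < e ->
  (P E <= (l0 * expR (- (lambda * (b - e))))%:E)%E.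
Proof.
move=> e0; have hF := standing_filtration hFSV.
have [_ _ _ /(_ _ lambda_ge0 lambda_lt)[L [hL L0 LX]]] := hSV.
have {}LX t : times R k t -> {ae P, forall w, expR (lambda * X t w) <= L t w}.
  move=> /LX; apply: filterS => w; apply: le_trans.
  by rewrite ler_expR /X mulrBr mulrA lambda_beta.
have [u [ut u_dense]] := times_dense_seq R k.
pose a := expR (lambda * (b - e)).
pose A := [set w | exists n, a <= L (u n) w].
have PA : (P A <= (l0 / a)%:E)%E.
  apply: (ville_countable hF) => //; first exact: expR_gt0.
    exact: le_trans l0_ge1.
  move=> n; split=> //; apply: filterS (LX _ (ut n)) => w; apply: le_trans.
  exact: expR_ge0.
have mA : measurable A.
  rewrite (_ : A = \bigcup_n [set w | a <= L (u n) w]); last first.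
    by apply/seteqP; split=> w; [case=> n h; exists n|case=> n _ h; exists n].
  apply: bigcup_measurable => n _; have un : times0 R k (u n) by right.
  by apply: (filtration_sub hF un); apply: adapted_ge (supermartingale_adapted hL) un.
have [N [mN N0 sN]] := negligible_bigcup (fun n => LX _ (ut n)).
rewrite expRN -/a; apply: le_trans PA.
rewrite -[leRHS]adde0 -[in leRHS]N0.
apply: le_trans (measureU2 P mA mN); apply: le_measure.
- by rewrite inE; exact: measurable_line_crossing.
- by rewrite inE; exact: measurableU.
move=> w [t ht bX].
have bX' : b - e < X t w by apply: lt_le_trans bX; rewrite gtrBl.
have [n bn] := u_dense (X ^~ w) (fun hk => @X_right_continuous hk w) t _ ht bX'.
have [Lw|Lw] := pselect (expR (lambda * X (u n) w) <= L (u n) w).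
  left; exists n; apply: le_trans Lw; rewrite ler_expR.
  by rewrite ler_wpM2l// ltW.
by right; apply: sN; exists n.
Qed.

(** The bound with level [b - e] is continuous in [e], and [e] tends to 0 from the right. *)
Lemma line_crossing : measurable E /\ (P E <= (l0 * expR (- (lambda * b)))%:E)%E.
Proof.
split; first exact: measurable_line_crossing.
have Pfin : P E \is a fin_num by rewrite fin_num_measure//; exact: measurable_line_crossing.
rewrite -(fineK Pfin) lee_fin.
have cont : continuous (fun e => l0 * expR (- (lambda * (b - e)))).
  move=> e; apply: cvgM; first exact: cvg_cst.
  apply: (continuous_comp (f := fun e => - (lambda * (b - e)))); last exact: continuous_expR.
  apply: cvgN; apply: cvgM; first exact: cvg_cst.
  by apply: cvgB; [exact: cvg_cst|exact: cvg_id].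
have cvgb : l0 * expR (- (lambda * (b - e))) @[e --> 0^'+]
    --> l0 * expR (- (lambda * b)).
  by rewrite -[X in _ --> l0 * expR (- (lambda * X))]subr0;
    exact: cvg_at_right_filter (cont 0).
apply: (cvgr_to_ge cvgb).
near=> e; rewrite -lee_fin fineK//; apply: relaxed_line_crossing.
near: e; exact: nbhs_right_gt.
Unshelve. all: by end_near. Qed.

End line_crossing.

(** * Algebra of the slope, the level and the exponent *)

Section scale_algebra.
Context {R : realType}.
Variables (c x m : R).
Hypotheses (x_gt0 : 0 < x) (m_gt0 : 0 < m).
Hypothesis x_lt : c < 0 -> x < 1 / (2 * `|c|).

Let a := Num.sqrt (1 + 2 * c * x).

Lemma scale_radicand_gt0 : 0 < 1 + 2 * c * x.
Proof.
have [c0|c0] := leP 0 c.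
  by rewrite ltr_pwDl// !mulr_ge0// ltW.
have := x_lt c0; rewrite ltr0_norm// ltr_pdivlMr; last by rewrite mulr_gt0// oppr_gt0.
by move=> h; lra.
Qed.

Let a_gt0 : 0 < a.
Proof. by rewrite sqrtr_gt0 scale_radicand_gt0. Qed.

(** Eliminates [c * x] in favour of [a], so that the identities below become rational in [a] and
    [x]. *)
Let cxE : c * x = (a ^+ 2 - 1) / 2.
Proof. by rewrite sqr_sqrtr ?ltW ?scale_radicand_gt0//; field. Qed.

Let a1_neq0 : 1 + a != 0.
Proof. by rewrite gt_eqF// ltr_pwDl// ltW. Qed.

(* The solution [lambda] of [lambda / (2 (1 - c lambda)) = sG c x]. *)
Definition line_parameter := 2 * x / (a * (1 + a)).

Lemma line_parameter_gt0 : 0 < line_parameter.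
Proof. by rewrite divr_gt0 ?mulr_gt0 ?addr_gt0. Qed.

Lemma scale_line_parameter : 1 - c * line_parameter = a^-1.
Proof.
have -> : c * line_parameter = 2 * (c * x) / (a * (1 + a)).
  by rewrite /line_parameter; ring.
by rewrite cxE; field; rewrite a1_neq0 gt_eqF.
Qed.

Lemma line_parameter_lt : (line_parameter%:E < ((Num.max c 0)%:E)^-1)%E.
Proof.
have [c0|c0] := leP c 0.
  by rewrite inve0 ltry.
rewrite inver gt_eqF// lte_fin -[ltRHS]mul1r ltr_pdivlMr// -subr_gt0 mulrC.
by rewrite scale_line_parameter invr_gt0.
Qed.

Lemma line_parameter_slope : line_parameter * sG c x =
  line_parameter ^+ 2 / (2 * (1 - c * line_parameter)).
Proof.
rewrite scale_line_parameter /sG -/a /line_parameter; field.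
by rewrite a1_neq0 gt_eqF.
Qed.

Lemma line_parameter_level :
  line_parameter * (sG c x * (m * a)) = m * psiG_star c x.
Proof.
rewrite /psiG_star /sG -/a cxE /line_parameter.
(* The denominator of [psiG_star] is half a perfect square, so [psiG_star c x] equals
   [2 x^2 / (1 + a)^2]. *)
have -> : 1 + (a ^+ 2 - 1) / 2 + a = (1 + a) ^+ 2 / 2 by field.
by field; rewrite a1_neq0 gt_eqF.
Qed.

(** Comparing denominators leaves [a <= 1 + c x = (1 + a^2) / 2], that is, [(a - 1)^2 >= 0]. *)
Lemma psiG_star_ge : m * x ^+ 2 / (2 * (1 + c * x)) <= m * psiG_star c x.
Proof.
have d2 : 0 < 1 + c * x by have := scale_radicand_gt0; lra.
have d1 : 0 < 1 + c * x + a by rewrite addr_gt0.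
rewrite /psiG_star -/a -mulrA ler_pM2l// ler_pM2l ?exprn_gt0//.
rewrite lef_pV2 ?posrE ?mulr_gt0//.
by have := sqr_ge0 (a - 1); rewrite cxE; nra.
Qed.

Lemma crossesE s v : 0 <= v ->
  crosses c x m s v <-> sG c x * (m * a) <= s - sG c x * v.
Proof.
move=> v0; rewrite /crosses -/a; case: eqVneq => [->|vn0].
  by rewrite add0r mulr0 subr0.
have v1 : 0 < v by rewrite lt_neqAle eq_sym vn0.
rewrite ler_pdivlMr// lerBrDr; suff -> : sG c x * (1 + m * a / v) * v =
  sG c x * (m * a) + sG c x * v by [].
by field.
Qed.

End scale_algebra.

Theorem corollary6 (R : realType) (d : measure_display) (T : measurableType d)
    (P : probability T R) (k : time_kind) (F : R -> set_system T)
    (S V : R -> T -> R) (l0 : R)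
    (hFSV : standing_assumptions P k F S V) (hl0 : 1 <= l0) :
  (forall c : R, sub_gamma P k F l0 c S V ->
   forall x m : R, 0 < x -> 0 < m -> (c < 0 -> x < 1 / (2 * `|c|)) ->
   let E := [set w | exists2 t, times R k t & crosses c x m (S t w) (V t w)] in
   [/\ measurable E,
       (P E <= (l0 * expR (- (m * psiG_star c x)))%:E)%E &
       l0 * expR (- (m * psiG_star c x))
       <= l0 * expR (- (m * x ^+ 2 / (2 * (1 + c * x))))]) /\
  (sub_gaussian P k F l0 S V ->
   forall x m : R, 0 < x -> 0 < m ->
   let E := [set w | exists2 t, times R k t & S t w / (V t w + m) >= x] in
   measurable E /\ (P E <= (l0 * expR (- (2 * m * x ^+ 2)))%:E)%E).
Proof.
have gamma c : sub_gamma P k F l0 c S V ->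
   forall x m : R, 0 < x -> 0 < m -> (c < 0 -> x < 1 / (2 * `|c|)) ->
   let E := [set w | exists2 t, times R k t & crosses c x m (S t w) (V t w)] in
   measurable E /\ (P E <= (l0 * expR (- (m * psiG_star c x)))%:E)%E.
  move=> hSV x m x0 m0 xc /=; have [_ _ V0 _] := hSV.
  rewrite -line_parameter_level//.
  set E := [set w | _].
  have -> : E = [set w | exists2 t, times R k t &
      sG c x * (m * Num.sqrt (1 + 2 * c * x)) <= S t w - sG c x * V t w].
    by apply/seteqP; split=> w [t ht h]; exists t => //; move: h;
      rewrite crossesE//; exact: V0.
  apply: (line_crossing hFSV hl0 hSV).
  - by rewrite ltW// line_parameter_gt0.
  - exact: line_parameter_lt.
  - exact: line_parameter_slope.
  - by rewrite !mulr_gt0 ?invr_gt0 ?sqrtr_gt0 ?scale_radicand_gt0// ltr_pwDl ?sqrtr_ge0.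
split=> [c hSV x m x0 m0 xc E|hSV x m x0 m0 E].
  have [mE PE] := gamma c hSV x m x0 m0 xc; split=> //.
  rewrite ler_pM2l; last exact: lt_le_trans hl0.
  by rewrite ler_expR lerN2 psiG_star_ge.
have [_ _ V0 _] := hSV.
(* At [c = 0] the square root is 1 and [sG] halves its argument, so slope [x] comes from the
   parameter [2 * x], with intercept [m * x] and exponent [2 m x^2]. *)
have x20 : 0 < 2 * x by rewrite mulr_gt0.
have xc : (0 : R) < 0 -> 2 * x < 1 / (2 * `|0 : R|) by rewrite ltxx.
have [mE PE] := gamma 0 hSV (2 * x) m x20 m0 xc.
have sqrt1 : Num.sqrt (1 + 2 * 0 * (2 * x)) = 1 :> R.
  by rewrite mulr0 mul0r addr0 sqrtr1.
have s0 : sG 0 (2 * x) = x by rewrite /sG sqrt1; field.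
have psi0 : m * psiG_star 0 (2 * x) = 2 * m * x ^+ 2.
  by rewrite /psiG_star sqrt1; field.
rewrite psi0 in PE.
rewrite (_ : E = [set w | exists2 t, times R k t &
    crosses 0 (2 * x) m (S t w) (V t w)]) //.
apply/seteqP; split=> w [t ht h]; exists t => //; move: h.
all: have Vt := V0 t w ht.
all: rewrite crossesE// sqrt1 s0 ler_pdivlMr ?ltr_wpDl// lerBrDr.
all: by rewrite mulr1 -mulrDr addrC.
Qed.
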